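(* Let $X$ and $Y$ be independent real-valued random variables, both with distribution function $F$ on $(\mathbb{R},\mathcal{B})$, and let $\psi:\mathbb{R}\to[0,\infty)$ be a nonnegative Borel measurable function. With $0<p<1$, $$\left\{E\left(\left(E\left(\frac{\psi(Y)}{F(Y)}\mathbf{1}_{[Y\ge X]}\,\Big|\,X\right)\right)^p\right)\right\}^{1/p}\ge p\,\left\{E\left(\psi^p(Y)\right)\right\}^{1/p}$$ holds.
   Context: $\mathcal{B}$ is the Borel $\sigma$-algebra on $\mathbb{R}$, $F(x)=P(X\le x)=P(Y\le x)$ is an arbitrary distribution function (atoms are allowed), $\mathbf{1}_{[\cdot]}$ denotes an indicator, $\psi^p(y)=(\psi(y))^p$, and $E(\cdot\mid X)$ denotes conditional expectation given $X$; thus $E\left(\frac{\psi(Y)}{F(Y)}\mathbf{1}_{[Y\ge X]}\mid X\right)=\int_{[X,\infty)}\frac{\psi}{F}\,dF$ almost surely. One has $F(Y)>0$ almost surely. All expectations and conditional expectations are of nonnegative quantities and take values in $[0,\infty]$, with $\infty^p=\infty^{1/p}=\infty$. *)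

(* Defs.v *)
From HB Require Import structures.
From mathcomp Require Import all_boot all_order all_algebra.
From mathcomp Require Import all_classical all_reals all_analysis.
From mathcomp Require Import measurable_realfun.

Set Implicit Arguments.
Unset Strict Implicit.
Unset Printing Implicit Defensive.

Import Order.TTheory GRing.Theory Num.Theory.
Import numFieldNormedType.Exports.

Local Open Scope classical_set_scope.
Local Open Scope ring_scope.
Local Open Scope ereal_scope.

Definition independent_RV (d : measure_display) (T : measurableType d)
    (R : realType) (P : probability T R) (X Y : {RV P >-> R}) : Prop :=
  forall A B : set R, measurable A -> measurable B ->
    P (X @^-1` A `&` Y @^-1` B) = P (X @^-1` A) * P (Y @^-1` B).

(* [Z] is a version of the conditional expectation of the [0, +oo]-valued
   function [f] given [X].  The sigma-algebra generated by [X] consists of the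
   preimages under [X] of the Borel sets; no integrability of [f] is required,
   and [Z] may take the value +oo. *)
Definition is_condexp (d : measure_display) (T : measurableType d)
    (R : realType) (P : probability T R) (X : {RV P >-> R})
    (f Z : T -> \bar R) : Prop :=
  [/\ forall w, 0 <= Z w,
      measurable_fun [set: g_sigma_algebra_preimageType X]
        (Z : g_sigma_algebra_preimageType X -> \bar R) &
      forall A : set T, g_sigma_algebra_preimage X A ->
        \int[P]_(w in A) Z w = \int[P]_(w in A) f w].

(* Main.v *)
(* Let mu be the common law of X and Y and G x the integral of psi / F over
   [x, +oo) with respect to mu.  By independence the conditional expectation
   given X is almost surely at least G(X), so it suffices to show
   p^p E[psi(X)^p] <= E[G(X)^p].
   Concavity of t^p gives, at atoms too, the integrated chain rule
     G(x)^p >= int_{[x,+oo)} p G^(p-1) (psi / F) dmu.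
   Integrating in x, Tonelli and mu(-oo, y] = F(y) turn this into
     int p G^(p-1) psi dmu <= int G^p dmu.
   The weighted AM-GM inequality p^p psi^p <= p (p G^(p-1) psi) + (1 - p) G^p
   then bounds p^p int psi^p dmu by int G^p dmu.  Zeros of G are avoided by
   working with G + e and letting e tend to 0. *)

Require Import Defs.
From HB Require Import structures.
From mathcomp Require Import all_boot all_order all_algebra.
From mathcomp Require Import all_classical all_reals all_analysis.
From mathcomp Require Import measurable_realfun.
From mathcomp Require Import ring.

Set Implicit Arguments.
Unset Strict Implicit.
Unset Printing Implicit Defensive.

Import Order.TTheory GRing.Theory Num.Theory.
Import numFieldNormedType.Exports.

Local Open Scope classical_set_scope.
Local Open Scope ring_scope.
Local Open Scope ereal_scope.

(** * Up-closed and down-closed sets of reals *)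

(** Such a set is the whole line or a ray, open or closed. The endpoints are [- n] if [U] is
    unbounded below, constantly [inf U] if the infimum is attained, and [inf U + 1/(n+1)]
    otherwise. *)
Lemma up_closed_bigcup (R : realType) (U : set R) :
    (forall x y, U x -> (x <= y)%R -> U y) -> U !=set0 ->
  exists a : R ^nat, [/\ nonincreasing_seq a, forall n, U (a n) &
    U = \bigcup_n `[a n, +oo[%classic].
Proof.
move=> upU [u Uu].
suff [a [na Ua coa]] : exists a : R ^nat, [/\ nonincreasing_seq a,
    forall n, U (a n) & forall y, U y -> exists n, (a n <= y)%R].
  exists a; split => //; apply/seteqP; split => y.
    by move=> /coa[n any]; exists n => //=; rewrite in_itv/= andbT.
  by move=> [n _] /=; rewrite in_itv/= andbT; exact: upU.
have [lbU|nlbU] := pselect (has_lbound U); last first.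
  exists (fun n => - n%:R)%R; split.
  - by move=> m n mn; rewrite lerN2 ler_nat.
  - move=> n; apply: contrapT => Un; apply: nlbU; exists (- n%:R)%R => y Uy.
    by rewrite leNgt; apply/negP => /ltW; move: Uy => /upU/[apply].
  - move=> y _; exists (Num.bound `|y|); rewrite lerNl.
    by rewrite (le_trans (ler_norm _))// normrN ltW// archi_boundP.
have iU : has_inf U by split => //; exists u.
have [Ui|nUi] := pselect (U (inf U)).
  exists (fun=> inf U); split => // y Uy; exists 0%N; exact: ge_inf.
exists (fun n => inf U + n.+1%:R^-1)%R; split.
- by move=> m n mn; rewrite lerD2l lef_pV2 ?posrE// ler_nat ltnS.
- move=> n; have n0 : (0 < n.+1%:R^-1 :> R)%R by rewrite invr_gt0.
  have [y Uy /ltW] := inf_adherent n0 iU; exact: upU.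
- move=> y Uy; have iy : (inf U < y)%R.
    rewrite lt_neqAle ge_inf// andbT; apply/eqP => E; apply: nUi; by rewrite E.
  have [n yn] : exists n, (n.+1%:R^-1 < y - inf U)%R.
    exists (Num.bound (y - inf U)^-1); rewrite invf_plt ?posrE ?subr_gt0//.
    apply: (lt_le_trans (archi_boundP _)).
      by rewrite invr_ge0 subr_ge0 ltW.
    by rewrite ler_nat.
  by exists n; rewrite -lerBrDl ltW.
Qed.

(** Monotone convergence along the closed rays of [up_closed_bigcup] carries the bound to open rays
    and to the whole line, so that later only closed rays have to be examined. *)
Lemma up_closed_integral_le (R : realType) (mu : {measure set R -> \bar R})
    (g : R -> \bar R) (U : set R) (c : \bar R) :
    measurable_fun setT g -> (forall y, 0 <= g y) -> 0 <= c ->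
    (forall x y, U x -> (x <= y)%R -> U y) ->
    (forall a, U a -> \int[mu]_(y in `[a, +oo[) g y <= c) ->
  \int[mu]_(y in U) g y <= c.
Proof.
move=> mg g0 c0 upU; have [->|/set0P U0] := eqVneq U set0.
  by rewrite integral_set0.
have [a [na Ua UE]] := up_closed_bigcup upU U0; move=> leUc.
rewrite UE.
have cvI : \int[mu]_(y in `[a n, +oo[) g y @[n --> \oo]
    --> \int[mu]_(y in \bigcup_n `[a n, +oo[%classic) g y.
  apply: ge0_nondecreasing_set_cvg_integral => //.
  - move=> m n mn; apply/subsetPset => y /=; rewrite !in_itv/= !andbT.
    by apply: le_trans; exact: na.
  - by move=> i; exact: measurable_funTS.
rewrite -(cvg_lim _ cvI)//; apply: lime_le.
  by apply/cvg_ex; eexists; exact: cvI.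
by apply: nearW => n; exact: leUc.
Qed.

(** Under the reflection [y -> - y] the set becomes up-closed, hence [D] is covered by countably
    many closed rays, each null by hypothesis. *)
Lemma down_closed_null (R : realType) (mu : {measure set R -> \bar R})
    (D : set R) :
    (forall x y, D y -> (x <= y)%R -> D x) ->
    (forall a, D a -> mu [set` `]-oo, a]] = 0) ->
  mu.-negligible D.
Proof.
move=> downD D0; have [->|/set0P [d Dd]] := eqVneq D set0.
  exact: negligible_set0.
have [||a [_ Da DE]] := @up_closed_bigcup R [set y | D (- y)%R].
- by move=> x y /= Dx xy; apply: downD Dx _; rewrite lerN2.
- by exists (- d)%R; rewrite /= opprK.
have null : mu.-negligible (\bigcup_n [set` `]-oo, (- a n)%R]]).
  apply: negligible_bigcup => n; apply/negligibleP => //.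
  by apply: D0; exact: Da.
apply: negligibleS null => y Dy.
have : [set y | D (- y)%R] (- y)%R by rewrite /= opprK.
rewrite DE => -[n _ /=]; rewrite in_itv/= andbT => any.
by exists n => //=; rewrite in_itv/= lerNr.
Qed.

(** * Layer-cake comparison of weighted integrals *)

(** Layer-cake formula: [phi y] is the Lebesgue length of [[0, phi y[], and Tonelli on the region
    [0 <= u < phi y] exchanges the two integrations. *)
Lemma ge0_integral_superlevel d (T : measurableType d) (R : realType)
    (mu : {sigma_finite_measure set T -> \bar R}) (phi g : T -> R)
    (S := fun u => \int[mu]_(y in [set y | (u < phi y)%R]) (g y)%:E) :
    measurable_fun setT phi -> measurable_fun setT g ->
    (forall y, 0 <= phi y)%R -> (forall y, 0 <= g y)%R ->
  measurable_fun (`[0%R, +oo[%classic : set (measurableTypeR R)) S /\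
  \int[mu]_y (phi y * g y)%:E = \int[lebesgue_measure]_(u in `[0%R, +oo[) S u.
Proof.
move=> mphi mg phi0 g0.
pose A : set (T * measurableTypeR R) := [set z | (0 <= z.2 < phi z.1)%R].
pose f (z : T * measurableTypeR R) : \bar R := (g z.1)%:E * (\1_A z)%:E.
have mA : measurable A.
  pose f0 (z : T * measurableTypeR R) := (0 <= z.2)%R.
  pose f1 (z : T * measurableTypeR R) := (z.2 < phi z.1)%R.
  rewrite [X in measurable X](_ : _ = f0 @^-1` [set true] `&` f1 @^-1` [set true]).
    apply: measurableI.
    - have : measurable_fun setT f0 by exact: measurable_fun_ler.
      by move=> /(_ measurableT [set true]); rewrite setTI; exact.
    - have : measurable_fun setT f1.
        by apply: measurable_fun_ltr => //; exact: measurableT_comp.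
      by move=> /(_ measurableT [set true]); rewrite setTI; exact.
  by apply/seteqP; split => z /= /andP.
have mg1 : measurable_fun setT (fun z : T * measurableTypeR R => g z.1).
  exact: measurableT_comp mg measurable_fst.
have mf : measurable_fun setT f.
  apply: emeasurable_funM; first exact/measurable_EFinP.
  by apply/measurable_EFinP/measurable_indic.
have f0 z : 0 <= f z by rewrite mule_ge0// lee_fin.
have SE (u : R) : (0 <= u)%R -> S u = \int[mu]_y f (y, u).
  move=> u0; rewrite /S integral_mkcond; apply: eq_integral => y _.
  rewrite patchE /f indicE /A; case: ifPn.
    by rewrite inE => /= uphi; rewrite mem_set/= ?u0// mule1.
  by rewrite notin_setE => /= uphi; rewrite memNset/= ?u0 ?mule0.
split.
  apply: (eq_measurable_fun (fun u : measurableTypeR R => \int[mu]_y f (y, u))).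
    by move=> u; rewrite inE/= in_itv/= andbT => /SE.
  apply: measurable_funTS; exact: (measurable_fun_fubini_tonelli_G f).
transitivity (\int[mu]_y \int[lebesgue_measure]_u f (y, u)).
  apply: eq_integral => y _; rewrite /f/=.
  have AyE : [set u : measurableTypeR R | A (y, u)] = `[0%R, phi y[%classic.
    by apply/seteqP; split => u /=; rewrite in_itv.
  rewrite ge0_integralZl//; last by rewrite lee_fin.
    rewrite (_ : (fun u => _) = fun u : measurableTypeR R =>
       (\1_([set u : measurableTypeR R | A (y, u)]) u)%:E)//.
    rewrite integral_indic//; last by rewrite AyE.
    rewrite setIT AyE/= lebesgue_measure_itv/= lte_fin lt_neqAle phi0 andbT.
    by case: eqVneq => [<-|_]; rewrite ?mul0r ?mule0// -EFinM subr0 mulrC.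
  by apply/measurable_EFinP/(measurableT_comp (measurable_indic mA)).
rewrite fubini_tonelli// [RHS]integral_mkcond; apply: eq_integral => u _.
rewrite patchE; case: ifPn => [|/negP].
  by rewrite inE/= in_itv/= andbT => /SE.
rewrite inE/= in_itv/= andbT => /negP u0; apply: integral0_eq => y _.
by rewrite /f indicE memNset ?mule0// /A/= (negbTE u0).
Qed.

(** Comparing level by level relates integrals over two different spaces. It takes the place of a
    change of variables from [mu] to Lebesgue measure, which atoms of [mu] would obstruct. *)
Lemma le_integral_superlevel d1 d2 (T1 : measurableType d1)
    (T2 : measurableType d2) (R : realType)
    (mu1 : {sigma_finite_measure set T1 -> \bar R})
    (mu2 : {sigma_finite_measure set T2 -> \bar R})
    (phi1 g1 : T1 -> R) (phi2 g2 : T2 -> R) :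
    measurable_fun setT phi1 -> measurable_fun setT g1 ->
    measurable_fun setT phi2 -> measurable_fun setT g2 ->
    (forall y, 0 <= phi1 y)%R -> (forall y, 0 <= g1 y)%R ->
    (forall y, 0 <= phi2 y)%R -> (forall y, 0 <= g2 y)%R ->
    (forall u : R, (0 <= u)%R ->
      \int[mu1]_(y in [set y | (u < phi1 y)%R]) (g1 y)%:E <=
      \int[mu2]_(y in [set y | (u < phi2 y)%R]) (g2 y)%:E) ->
  \int[mu1]_y (phi1 y * g1 y)%:E <= \int[mu2]_y (phi2 y * g2 y)%:E.
Proof.
move=> mphi1 mg1 mphi2 mg2 phi1_ge0 g1_ge0 phi2_ge0 g2_ge0 le12.
have [mS1 ->] := ge0_integral_superlevel mu1 mphi1 mg1 phi1_ge0 g1_ge0.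
have [mS2 ->] := ge0_integral_superlevel mu2 mphi2 mg2 phi2_ge0 g2_ge0.
apply: ge0_le_integral => //.
  by move=> u _; apply: integral_ge0 => y _; rewrite lee_fin.
by move=> u /=; rewrite in_itv/= andbT; exact: le12.
Qed.

(** * Power functions and the integrated chain rule *)

Lemma le0_ler_powR (R : realType) (q a b : R) : (q <= 0)%R -> (0 < a)%R ->
  (a <= b)%R -> (b `^ q <= a `^ q)%R.
Proof.
move=> q0 a0 ab; have b0 : (0 < b)%R by exact: lt_le_trans ab.
rewrite -(opprK q) (powRN b) (powRN a) lef_pV2; [|by rewrite posrE powR_gt0..].
by apply: ge0_ler_powR => //; rewrite ?oppr_ge0// nnegrE ltW.
Qed.

(** Fundamental theorem of calculus; [0 < a] keeps the interval away from the singularity at 0. *)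
Lemma integral_powR_itv (R : realType) (p a b : R) : (0 < a)%R -> (a <= b)%R ->
  \int[lebesgue_measure]_(s in `[a, b]) (p * s `^ (p - 1))%:E =
  (b `^ p - a `^ p)%:E.
Proof.
move=> a0; rewrite le_eqVlt => /predU1P[<-|ab].
  by rewrite set_itv1 (integral_Sset1 a)// subrr.
have cont (q s : R) : (a <= s)%R -> {for s, continuous (@powR R ^~ q)}.
  move=> as_; have s0 : (0 < s)%R by exact: lt_le_trans as_.
  apply/differentiable_continuous/derivable1_diffP.
  by have [] := is_derive1_powR q s0.
rewrite (@continuous_FTC2 _ _ (@powR R ^~ p))//.
- apply: continuous_in_subspaceT => s; rewrite inE/= in_itv/= => /andP[as_ _].
  by apply: cvgMr; exact: cont.
- split.
  + move=> s; rewrite in_itv/= => /andP[as_ _].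
    by have [] := is_derive1_powR p (lt_trans a0 as_).
  + by apply: cvg_at_right_filter; exact: cont.
  + by apply: cvg_at_left_filter; apply: cont; exact: ltW.
- move=> s; rewrite in_itv/= => /andP[as_ _].
  have d := is_derive1_powR p (lt_trans a0 as_).
  by rewrite derive1E derive_val.
Qed.
(* The superlevel sets of the weight [p (e + G)^(p-1)] are up-closed.  On a ray
   [[a, +oo[] in such a set the mass of [g] is [G a], and since [s^(p-1)] is
   decreasing this is at most the Lebesgue mass of the corresponding superlevel
   set of [p s^(p-1)] on [[e, e + G x]].  Where [G y] is infinite, [fine (G y)]
   is [0]; then [G x] is infinite as well and the bound is trivial. *)
Lemma tail_powR_integral (R : realType)
    (mu : {sigma_finite_measure set R -> \bar R}) (g : R -> R) (e p x : R)
    (G := fun y => \int[mu]_(t in `[y, +oo[) (g t)%:E) :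
    measurable_fun setT g -> (forall y, 0 <= g y)%R ->
    (0 < e)%R -> (0 < p)%R -> (p < 1)%R ->
  \int[mu]_(y in `[x, +oo[) (p * (e + fine (G y)) `^ (p - 1) * g y)%:E <=
  (G x + e%:E) `^ p.
Proof.
move=> mg g0 e0 p0 p1.
have G0 y : 0 <= G y by apply: integral_ge0 => t _; rewrite lee_fin.
have Gni y z : (y <= z)%R -> G z <= G y.
  move=> yz; apply: ge0_subset_integral => //.
  - by apply/measurable_EFinP; exact: measurable_funTS.
  - by move=> t _; rewrite lee_fin.
  - by move=> t /=; rewrite !in_itv/= !andbT; exact: le_trans.
have [Gxoo|Gxoo] := eqVneq (G x) +oo.
  by rewrite Gxoo addye// poweRyr ?gt_eqF// leey.
have Gfin y : (x <= y)%R -> G y \is a fin_num.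
  by move=> /Gni xy; rewrite ge0_fin_numE// (le_lt_trans xy)// ltey.
pose M := fine (G x).
(* The maximum freezes the weight to the left of [x], where [g1] vanishes. This makes [phi1]
   monotone on the whole line, and only finite values of [G] enter. *)
pose phi1 (y : R) := (p * (e + fine (G (Num.max x y))) `^ (p - 1))%R.
pose g1 (y : R) := (g y * \1_(`[x, +oo[%classic) y)%R.
pose phi2 (s : measurableTypeR R) := (p * s `^ (p - 1))%R.
pose J : set (measurableTypeR R) := `[e, (e + M)%R]%classic.
pose g2 (s : measurableTypeR R) : R := \1_J s.
have mphi2 : measurable_fun setT phi2.
  exact: measurable_funM.
have mJ : measurable J by exact: measurable_itv.
have mg2 : measurable_fun setT g2 by apply: (measurable_indic mJ).
have M0 : (0 <= M)%R by rewrite fine_ge0.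
have max_x y : (x <= Num.max x y)%R by rewrite le_max lexx.
have phi1_nd : {homo phi1 : y z / (y <= z)%R}.
  move=> y z yz; apply: ler_wpM2l; first exact: ltW.
  have fG u : (0 < e + fine (G u))%R by rewrite ltr_wpDr// fine_ge0.
  apply: le0_ler_powR; first by rewrite subr_le0 ltW.
    exact: fG.
  rewrite lerD2l fine_le ?Gfin ?max_x// Gni// ge_max le_max lexx/=.
  by rewrite le_max yz orbT.
(* As [phi2] decreases on the positive axis, every [s] in [[e, a]] has [phi2 s >= phi2 a > u]; so
   the superlevel set meets [J] in at least [[e, a]]. *)
have Jm (a : R) : (e <= a)%R -> (a <= e + M)%R -> forall u, (u < phi2 a)%R ->
    (a - e)%:E <=
    \int[lebesgue_measure]_(s in [set s | (u < phi2 s)%R]) (g2 s)%:E.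
  move=> ea aM u ua.
  have mK : measurable [set s | (u < phi2 s)%R].
    have : measurable_fun setT (fun s => (u < phi2 s)%R).
      exact: measurable_fun_ltr.
    by move=> /(_ measurableT [set true]); rewrite setTI; exact.
  rewrite integral_indic//.
  have -> : (a - e)%:E = lebesgue_measure (`[e, a]%classic : set R).
    rewrite lebesgue_measure_itv/= lte_fin.
    by case: ltgtP ea => // -> _; rewrite subrr.
  apply: le_measure; rewrite ?inE//; first exact: measurableI.
  move=> s /=; rewrite !in_itv/= => /andP[es sa]; split.
    by rewrite /J/= in_itv/= es (le_trans sa).
  apply: lt_le_trans ua _; apply: ler_wpM2l; first exact: ltW.
  apply: le0_ler_powR => //; first by rewrite subr_le0 ltW.
  exact: lt_le_trans es.
apply: (@le_trans _ _ (\int[mu]_y (phi1 y * g1 y)%:E)).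
  rewrite integral_mkcond le_eqVlt; apply/orP; left; apply/eqP.
  apply: eq_integral => y _; rewrite patchE /g1 indicE; case: ifPn => [|_].
    by rewrite inE/= in_itv/= andbT mulr1 /phi1 => /max_idPr ->.
  by rewrite !mulr0.
apply: (@le_trans _ _ (\int[lebesgue_measure]_s (phi2 s * g2 s)%:E));
    last first.
  rewrite (_ : \int[_]_s _ = \int[lebesgue_measure]_(s in J) (phi2 s)%:E);
      last first.
    rewrite [RHS]integral_mkcond; apply: eq_integral => s _.
    by rewrite patchE /g2 indicE; case: ifPn => _; rewrite ?mulr1 ?mulr0.
  (* The integral is [(e + M)^p - e^p]; the negative term is dropped. *)
  rewrite integral_powR_itv ?lerDl//.
  rewrite -(fineK (Gfin x _))// -EFinD poweR_EFin lee_fin (addrC _ e).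
  by rewrite gerDl oppr_le0 powR_ge0.
apply: le_integral_superlevel => //.
- apply: nondecreasing_measurable => //.
- apply: measurable_funM => //; exact: measurable_indic.
- by move=> y; rewrite mulr_ge0 ?powR_ge0// ltW.
- by move=> y; rewrite mulr_ge0.
- by move=> y; rewrite mulr_ge0 ?powR_ge0// ltW.
move=> u u0.
have g1E A : \int[mu]_(y in A) (g1 y)%:E =
    \int[mu]_(y in A `&` `[x, +oo[) (g y)%:E.
  rewrite integral_mkcondr; apply: eq_integral => y _.
  by rewrite patchE /g1 indicE; case: ifPn => _; rewrite ?mulr1 ?mulr0.
apply: up_closed_integral_le.
- apply/measurable_EFinP.
  by apply: measurable_funM => //; exact: measurable_indic.
- by move=> y; rewrite lee_fin mulr_ge0.
- by apply: integral_ge0 => s _; rewrite lee_fin.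
- by move=> y z /= + yz => /lt_le_trans; apply; exact: phi1_nd.
move=> a ua; rewrite g1E.
rewrite (_ : _ `&` _ = `[Num.max x a, +oo[%classic); last first.
  by apply/seteqP; split => y /=; rewrite !in_itv/= !andbT ge_max andbC => /andP.
rewrite -/(G _) -[G _]fineK ?Gfin ?max_x//.
(* By definition [phi1 a] is [phi2] at the point [e + fine (G (Num.max x a))], so [ua] is the
   hypothesis of [Jm] at that point, and the length there is the mass of [g] on the ray. *)
have {1}-> : fine (G (Num.max x a)) = (e + fine (G (Num.max x a)) - e)%R.
  by rewrite addrC addKr.
apply: Jm ua.
- by rewrite lerDl fine_ge0.
- by rewrite lerD2l fine_le ?Gfin ?max_x// Gni.
Qed.

(** * Weighted AM-GM, Tonelli on a half-plane, subadditivity of powers *)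

(** Young's inequality with conjugate exponents [1/p] and [1/(1-p)], applied to [(p h^(p-1) a)^p]
    and [(h^p)^(1-p)]; in their product the powers of [h] cancel. *)
Lemma powR_young (R : realType) (p a h : R) :
    (0 < p)%R -> (p < 1)%R -> (0 <= a)%R -> (0 < h)%R ->
  (p `^ p * a `^ p <= p * (p * h `^ (p - 1) * a) + (1 - p) * h `^ p)%R.
Proof.
move=> p0 p1 a0 h0; have q0 : (0 < 1 - p)%R by rewrite subr_gt0.
have hp0 q : (0 <= h `^ q)%R by exact: powR_ge0.
have pha : (0 <= p * h `^ (p - 1) * a)%R by rewrite !mulr_ge0// ltW.
have := @conjugate_powR R ((p * h `^ (p - 1) * a) `^ p)%R ((h `^ p) `^ (1 - p))%R
  p^-1%R (1 - p)^-1%R (powR_ge0 _ _) (powR_ge0 _ _).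
rewrite !invr_gt0 !invrK subrKC => /(_ p0 q0 erefl).
rewrite -!powRrM.
rewrite mulfV ?gt_eqF// powRr1//.
rewrite -(mulrA p (1 - p)%R) mulfV ?gt_eqF// mulr1 => H.
rewrite (mulrC p (_ * _ * _)%R) (mulrC (1 - p)%R); apply: le_trans H.
have ph0 : (0 <= p * h `^ (p - 1))%R by rewrite mulr_ge0 ?hp0 ?ltW.
rewrite (powRM _ ph0 a0) (powRM _ (ltW p0) (hp0 _)) -(powRrM h).
have hh : (h `^ ((p - 1) * p) * h `^ (p * (1 - p)) = 1)%R.
  rewrite (_ : (p - 1) * p = - (p * (1 - p)))%R; last by ring.
  by rewrite powRN mulVf// gt_eqF// powR_gt0.
rewrite (mulrAC _ (a `^ p)%R) -(mulrA (p `^ p)%R) hh mulr1; exact: lexx.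
Qed.
Lemma measurable_ler_graph (R : realType) :
  measurable [set z : R * R | (z.1 <= z.2)%R].
Proof.
have : measurable_fun setT (fun z : R * R => (z.1 <= z.2)%R).
  exact: measurable_fun_ler.
by move=> /(_ measurableT [set true]); rewrite setTI; exact.
Qed.

(** Tonelli on the half-plane [x <= y]: a fixed [y] is seen by exactly the [x] in []-oo, y]]. The
    mass of this ray is what later cancels the denominator of [psi / F]. *)
Lemma tail_integral_tonelli (R : realType)
    (mu : {sigma_finite_measure set R -> \bar R}) (h : R -> R)
    (T := fun x => \int[mu]_(y in `[x, +oo[) (h y)%:E) :
    measurable_fun setT h -> (forall y, 0 <= h y)%R ->
  measurable_fun setT T /\
  \int[mu]_x T x = \int[mu]_y ((h y)%:E * mu [set` `]-oo, y]]).
Proof.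
move=> mh h0.
pose A : set (R * R) := [set z | (z.1 <= z.2)%R].
pose f (z : R * R) : \bar R := (h z.2)%:E * (\1_A z)%:E.
have mA : measurable A by exact: measurable_ler_graph.
have mf : measurable_fun setT f.
  apply: emeasurable_funM; apply/measurable_EFinP; last exact: measurable_indic.
  exact: measurableT_comp mh measurable_snd.
have f0 z : 0 <= f z by rewrite mule_ge0// lee_fin.
have TE x : T x = \int[mu]_y f (x, y).
  rewrite /T integral_mkcond; apply: eq_integral => y _.
  rewrite patchE /f indicE /A /=; case: ifPn.
    by rewrite inE/= in_itv/= andbT => xy; rewrite mem_set// mule1.
  by rewrite notin_setE/= in_itv/= andbT => xy; rewrite memNset// mule0.
split.
  have -> : T = fun x => \int[mu]_y f (x, y) by apply/funext.
  exact: (measurable_fun_fubini_tonelli_F f).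
under eq_integral do rewrite TE.
rewrite fubini_tonelli//; apply: eq_integral => y _; rewrite /f/=.
rewrite ge0_integralZl//; last by rewrite lee_fin.
  rewrite (_ : (fun x => _) = fun x => (\1_[set` `]-oo, y]] x)%:E).
    by rewrite integral_indic// setIT.
  apply/funext => x; rewrite !indicE; have [xy|xy] := boolP (x <= y)%R.
    by rewrite !mem_set//= in_itv.
  by rewrite !memNset//= ?in_itv/=; apply/negP.
by apply/measurable_EFinP/(measurableT_comp (measurable_indic mA)).
Qed.

(** For [t] in [[0, x + e]] the ratio [t / (x + e)] is at most its own [p]-th power; adding this for
    [t = x] and [t = e] gives subadditivity. *)
Lemma poweRD_le (R : realType) (p e : R) (x : \bar R) :
    (0 < p)%R -> (p < 1)%R -> (0 < e)%R -> 0 <= x ->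
  (x + e%:E) `^ p <= x `^ p + (e `^ p)%:E.
Proof.
move=> p0 p1 e0; case: x => [x|_|//]; last by rewrite /= gt_eqF// leey.
rewrite lee_fin -EFinD !poweR_EFin -EFinD lee_fin => x0.
have s0 : (0 < x + e)%R by rewrite ltr_wpDl.
have sp : (0 < (x + e) `^ p)%R by exact: powR_gt0.
have le1 (t : R) : (0 <= t)%R -> (t <= x + e)%R ->
    (t / (x + e) * (x + e) `^ p <= t `^ p)%R.
  move=> t0 ts; have [->|tn0] := eqVneq t 0%R.
    by rewrite !mul0r powR_ge0.
  have {tn0}t0 : (0 < t)%R by rewrite lt_neqAle eq_sym tn0.
  have ts0 : (0 < t / (x + e))%R by rewrite divr_gt0.
  rewrite -[in leRHS](@divfK _ (x + e)%R _ t) ?gt_eqF//.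
  rewrite (powRM _ (ltW ts0) (ltW s0)).
  rewrite ler_pM2r//; apply: ger1_powR; last exact: ltW.
  by rewrite ts0 ler_pdivrMr// mul1r.
rewrite -[leLHS]mul1r -[X in (X * _ <= _)%R](@divff _ (x + e)%R) ?gt_eqF//.
rewrite mulrDl mulrDl; apply: lerD; apply: le1.
- exact: x0.
- by rewrite lerDl ltW.
- exact: ltW.
- by rewrite lerDr.
Qed.
Lemma measurable_fun_div_ge0 d (T : measurableType d) (R : realType)
    (f g : T -> R) :
    measurable_fun setT f -> measurable_fun setT g -> (forall x, 0 <= g x)%R ->
  measurable_fun setT (fun x => f x / g x)%R.
Proof.
move=> mf mg g0.
(* This is also correct where [g x = 0]: both [0^-1] and [0 `^ (-1)] are [0]. *)
rewrite (_ : (fun x => _) = fun x => f x * g x `^ (-1))%R; last first.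
  by apply/funext => x; rewrite powR_inv1.
by apply: measurable_funM => //; exact: (measurableT_comp (measurable_powR _)).
Qed.

(** * Hardy-type inequality for a probability law on the line *)

Section hardy_tail.
Variables (R : realType) (mu : probability R R) (psi : R -> R) (p : R).
Hypotheses (mpsi : measurable_fun setT psi) (psi0 : forall y, (0 <= psi y)%R).
Hypotheses (p0 : (0 < p)%R) (p1 : (p < 1)%R).

Let F (y : R) : R := fine (mu [set` `]-oo, y]]).
Let g (y : R) : R := (psi y / F y)%R.
Let G (x : R) := \int[mu]_(y in `[x, +oo[) (g y)%:E.

Let FE (y : R) : mu [set` `]-oo, y]] = (F y)%:E.
Proof. by rewrite fineK// fin_num_measure. Qed.

Let F0 (y : R) : (0 <= F y)%R. Proof. by rewrite fine_ge0. Qed.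

Let F_nd : {homo F : x y / (x <= y)%R}.
Proof.
move=> x y xy; rewrite fine_le ?fin_num_measure// le_measure ?inE//.
by move=> z /=; rewrite !in_itv/= => /le_trans; exact.
Qed.

Let mF : measurable_fun setT F. Proof. exact: nondecreasing_measurable. Qed.

Let mg : measurable_fun setT g.
Proof. exact: measurable_fun_div_ge0. Qed.

Let g0 (y : R) : (0 <= g y)%R. Proof. exact: divr_ge0. Qed.

Let G0 (x : R) : 0 <= G x.
Proof. by apply: integral_ge0 => y _; rewrite lee_fin. Qed.

Let mG : measurable_fun setT G.
Proof. by have [] := tail_integral_tonelli mu mg g0. Qed.

(** The zero set of [F] is down-closed, and each of its points [a] ends a null ray []-oo, a]]. Hence
    the convention [0^-1 = 0] affects [psi / F] only on a null set. *)
Let F_ae_neq0 : {ae mu, forall y, F y != 0%R}.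
Proof.
have null : mu.-negligible [set y | F y = 0%R].
  apply: down_closed_null; last by move=> a /= Fa; rewrite FE Fa.
  by move=> x y /= Fy0 xy; apply/eqP; rewrite eq_le F0 andbT -Fy0; exact: F_nd.
by apply: negligibleS null => y /= /negP; rewrite negbK => /eqP.
Qed.

Let w (e y : R) : R := (p * (e + fine (G y)) `^ (p - 1))%R.

Let w0 (e y : R) : (0 <= w e y)%R.
Proof. by apply: mulr_ge0; [exact: ltW|exact: powR_ge0]. Qed.

Let mw (e : R) : measurable_fun setT (w e).
Proof.
apply: measurable_funM => //.
apply: (measurableT_comp (measurable_powR (p - 1)%R)).
by apply: measurable_funD => //; exact: measurableT_comp.
Qed.

Let mGp (e : R) : measurable_fun setT (fun x => (G x + e%:E) `^ p).
Proof.
apply: (measurableT_comp (measurable_poweR p)).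
exact: emeasurable_funD.
Qed.

(** Tonelli for [w e y * g y] produces the factor [F y], which almost everywhere turns [g] back into
    [psi]; the inner tail integrals are bounded by [tail_powR_integral]. *)
Let integral_w_psi (e : R) : (0 < e)%R ->
  \int[mu]_y (w e y * psi y)%:E <= \int[mu]_x (G x + e%:E) `^ p.
Proof.
move=> e0.
have wg0 y : (0 <= w e y * g y)%R by exact: mulr_ge0.
have mwg : measurable_fun setT (fun y => w e y * g y)%R.
  exact: measurable_funM (mw e) mg.
have [mT TE] := tail_integral_tonelli mu mwg wg0.
apply: (@le_trans _ _ (\int[mu]_x \int[mu]_(y in `[x, +oo[) (w e y * g y)%:E)).
  rewrite TE [leRHS](eq_integral (fun y => (w e y * g y * F y)%:E)); last first.
    by move=> y _; rewrite [RHS]EFinM; congr (_ * _); exact: FE.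
  rewrite le_eqVlt; apply/orP; left; apply/eqP.
  apply: ge0_ae_eq_integral => //.
  - by apply/measurable_EFinP; exact: measurable_funM (mw e) mpsi.
  - by apply/measurable_EFinP; exact: measurable_funM mwg mF.
  - by move=> y _; rewrite lee_fin; exact: mulr_ge0.
  - by move=> y _; rewrite lee_fin; exact: mulr_ge0.
  - by apply: filterS F_ae_neq0 => y Fy _; rewrite /g -[in RHS]mulrA divfK.
apply: ge0_le_integral => //.
  by move=> x _; apply: integral_ge0 => y _; rewrite lee_fin.
by move=> x _; exact: tail_powR_integral.
Qed.

(** Integrating [powR_young] with [h = G y + e] bounds the left side by [p I + (1 - p) I = I].
    Nothing is subtracted, so [I] may be infinite. *)
Let hardy_shift (e : R) : (0 < e)%R ->
  (p `^ p)%:E * \int[mu]_y (psi y `^ p)%:E <= \int[mu]_x (G x + e%:E) `^ p.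
Proof.
move=> e0; set I := \int[mu]_x (G x + e%:E) `^ p.
have q0 : (0 <= 1 - p)%R by rewrite subr_ge0 ltW.
have mpsip : measurable_fun setT (fun y => (psi y `^ p)%:E).
  by apply/measurable_EFinP; exact: (measurableT_comp (measurable_powR p)).
have mwpsi : measurable_fun setT (fun y => (w e y * psi y)%:E).
  by apply/measurable_EFinP; exact: measurable_funM (mw e) mpsi.
have wpsi0 y : 0 <= (w e y * psi y)%:E by rewrite lee_fin mulr_ge0.
rewrite -ge0_integralZl//; [|by move=> y _; rewrite lee_fin powR_ge0|
  by rewrite lee_fin powR_ge0].
apply: (@le_trans _ _ (\int[mu]_y
    (p%:E * (w e y * psi y)%:E + (1 - p)%:E * (G y + e%:E) `^ p))).
  apply: ge0_le_integral => //.
  - by move=> y _; rewrite mule_ge0 ?lee_fin ?powR_ge0.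
  - exact: measurable_funeM.
  - by apply: emeasurable_funD; exact: measurable_funeM.
  move=> y _.
  (* Where [G y] is infinite, [fine] would lose its value; there the right side is [+oo] because
     [1 - p > 0]. *)
  have [Gy|Gy] := eqVneq (G y) +oo.
    rewrite Gy addye// poweRyr ?gt_eqF// gt0_muley ?lte_fin ?subr_gt0//.
    by rewrite addey ?leey// -EFinM.
  have Gyfin : G y \is a fin_num by rewrite ge0_fin_numE// ltey.
  have -> : (G y + e%:E) `^ p = ((e + fine (G y)) `^ p)%:E.
    by rewrite -{1}(fineK Gyfin) -EFinD addrC poweR_EFin.
  rewrite -!EFinM -EFinD lee_fin.
  by apply: powR_young => //; rewrite ltr_wpDr// fine_ge0.
rewrite ge0_integralD//; last 4 first.
- by move=> y _; rewrite mule_ge0// lee_fin ltW.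
- exact: measurable_funeM.
- by move=> y _; rewrite mule_ge0 ?poweR_ge0 ?lee_fin.
- exact: measurable_funeM.
rewrite !ge0_integralZl//;
  [|by move=> y _; exact: poweR_ge0|by rewrite lee_fin ltW].
rewrite -/I; apply: (@le_trans _ _ (p%:E * I + (1 - p)%:E * I)).
  apply: leeD => //; apply: lee_wpmul2l; first by rewrite lee_fin ltW.
  exact: integral_w_psi.
rewrite -ge0_muleDl; [|by rewrite lee_fin ltW|by rewrite lee_fin].
by rewrite -EFinD subrKC mul1e.
Qed.

Lemma hardy_tail :
  (p `^ p)%:E * \int[mu]_y (psi y `^ p)%:E <= \int[mu]_x (G x `^ p).
Proof.
apply/lee_addgt0Pr => d d0.
(* With this choice [e^p = d], and since [mu] has total mass 1, removing the shift by subadditivity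
   costs exactly [d]. *)
pose e := (d `^ p^-1)%R.
have e0 : (0 < e)%R by exact: powR_gt0.
have ep : (e `^ p = d)%R by rewrite /e -powRrM mulVf ?gt_eqF// powRr1// ltW.
apply: (le_trans (hardy_shift e0)).
have mGp0 : measurable_fun setT (fun x => G x `^ p).
  exact: (measurableT_comp (measurable_poweR p)).
apply: (@le_trans _ _ (\int[mu]_x (G x `^ p + d%:E))).
  apply: ge0_le_integral => //.
  - by move=> x _; exact: poweR_ge0.
  - exact: emeasurable_funD.
  - by move=> x _; rewrite -ep; exact: poweRD_le.
rewrite ge0_integralD//; last 2 first.
- by move=> x _; exact: poweR_ge0.
- by move=> x _; rewrite lee_fin ltW.
rewrite integral_cst// [X in d%:E * X](_ : _ = 1) ?mule1//.
exact: probability_setT.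
Qed.

End hardy_tail.

(** * Laws, independence and conditional expectation *)

(** The intervals []a, b]] form a generating class stable under intersection, and each is a
    difference of two rays of finite mass. *)
Lemma probability_eq_rays (R : realType) (mu nu : probability R R) :
    (forall x : R, mu [set` `]-oo, x]] = nu [set` `]-oo, x]]) ->
  forall A, measurable A -> mu A = nu A.
Proof.
move=> munu; apply: (@measure_unique _ _ _ (@ocitv R)
    (fun n => [set` `](- n%:R)%R, n%:R]])) => //.
- exact: ocitvI.
- by move=> n; exact: is_ocitv.
- apply/seteqP; split => // x _.
  exists (Num.bound `|x|).+1 => //=; rewrite in_itv/= ltrNl.
  have xn : (`|x| < (Num.bound `|x|).+1%:R)%R.
    by rewrite (lt_trans (archi_boundP _))// ltr_nat.
  rewrite (le_lt_trans _ xn) ?(le_trans _ (ltW xn)) ?ler_norm//.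
  by rewrite -normrN ler_norm.
- move=> A [[a b] _ <-] /=.
  have [ab|ba] := leP a b; last first.
    by rewrite set_itv_ge ?measure0// bnd_simp -leNgt ltW.
  have -> : `]a, b]%classic = `]-oo, b] `\` `]-oo, a].
    by rewrite -[RHS]setCK setCD setCitvl setUC -[LHS]setCK setCitv.
  rewrite !measureD ?setIidr//; try exact: subset_itvl.
  - by congr (_ - _); exact: munu.
  - by rewrite -ge0_fin_numE// fin_num_measure.
  - by rewrite -ge0_fin_numE// fin_num_measure.
by move=> k; rewrite -ge0_fin_numE// fin_num_measure.
Qed.
(** Independence says that the joint law agrees with the product measure on rectangles, hence
    everywhere; Tonelli then applies to the pushforward. *)
Lemma independent_RV_tonelli d (T : measurableType d) (R : realType)
    (P : probability T R) (X Y : {RV P >-> R}) (f : R * R -> \bar R) :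
    independent_RV X Y -> measurable_fun setT f -> (forall z, 0 <= f z) ->
  \int[P]_w f (X w, Y w) =
  \int[distribution P X]_x \int[distribution P Y]_y f (x, y).
Proof.
move=> indXY mf f0.
have mXY : measurable_fun setT (fun w => (X w, Y w)).
  by apply/measurable_fun_pairP; split.
rewrite -[LHS](@ge0_integral_pushforward _ _ _ _ _ _ mXY P setT f)//.
rewrite -(@fubini_tonelli1 _ _ _ _ _ (distribution P X) (distribution P Y) f)//.
apply/esym/eq_measure_integral => A mA _.
exact: product_measure_unique.
Qed.

(** The exceptional set is the union of the sets [N n], which belong to the sigma-algebra of [X]. On
    [N n] the functions [Z] and [H (X w)] have the same integral, finite because [Z <= n], yet
    differ by at least [c n]; so [N n] is null. The truncation handles infinite values of [Z]. *)
Lemma condexp_ge d (T : measurableType d) (R : realType)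
    (P : probability T R) (X : {RV P >-> R}) (f Z : T -> \bar R)
    (H : R -> \bar R) :
    is_condexp X f Z -> measurable_fun setT H -> (forall x, 0 <= H x) ->
    (forall B, measurable B ->
      \int[P]_(w in X @^-1` B) H (X w) = \int[P]_(w in X @^-1` B) f w) ->
  {ae P, forall w, H (X w) <= Z w}.
Proof.
move=> [Z0 mZ ZE] mH H0 HE.
pose c n : R := n.+1%:R^-1%R.
have c0 n : (0 < c n)%R by rewrite invr_gt0.
pose N n := [set w | Z w <= n%:R%:E] `&` [set w | (c n)%:E <= H (X w) - Z w].
have measX A : g_sigma_algebra_preimage X A -> measurable A.
  move=> [B mB <-]; exact: measurable_funP.
have mHX : measurable_fun [set: g_sigma_algebra_preimageType X]
    (H \o X : g_sigma_algebra_preimageType X -> \bar R).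
  move=> _ B mB; exists (H @^-1` B); last by rewrite !setTI.
  by rewrite -[X in measurable X]setTI; exact: mH.
have sN n : g_sigma_algebra_preimage X (N n).
  apply: (@measurableI _ (g_sigma_algebra_preimageType X)).
    by rewrite -[X in measurable X]setTI; exact: emeasurable_fun_infty_c.
  rewrite -[X in measurable X]setTI; apply: emeasurable_fun_c_infty => //.
  exact: emeasurable_funB.
have mZT : measurable_fun setT Z.
  by move=> _ B mB; apply: measX; exact: mZ.
have mHXT : measurable_fun setT (H \o X) by exact: measurableT_comp.
have null : P.-negligible (\bigcup_n N n).
  apply: negligible_bigcup => n.
  have mN := measX _ (sN n).
  apply/negligibleP => //.
  have [B mB BE] := sN n; rewrite setTI in BE.
  have ZHE : \int[P]_(w in N n) Z w = \int[P]_(w in N n) H (X w).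
    by rewrite -BE ZE -?HE//; exists B => //; rewrite setTI.
  have Zfin w : N n w -> Z w \is a fin_num.
    by move=> [/= Zn _]; rewrite ge0_fin_numE// (le_lt_trans Zn)// ltry.
  have IZfin : \int[P]_(w in N n) Z w \is a fin_num.
    rewrite ge0_fin_numE ?integral_ge0//.
    apply: (@le_lt_trans _ _ (\int[P]_(w in N n) cst n%:R%:E w)).
      apply: ge0_le_integral => //; [exact: measurable_funTS|].
      by move=> w [].
    rewrite integral_cst// -ge0_fin_numE ?mule_ge0//.
    by rewrite fin_numM// fin_num_measure.
  have : \int[P]_(w in N n) (Z w + (c n)%:E) <= \int[P]_(w in N n) Z w.
    rewrite ZHE; apply: ge0_le_integral => //.
    - by move=> w _; rewrite adde_ge0// lee_fin ltW.
    - by apply: emeasurable_funD => //; exact: measurable_funTS.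
    - exact: measurable_funTS.
    - by move=> w Nw; have [_ /=] := Nw; rewrite leeBrDr ?Zfin// addeC.
  rewrite ge0_integralD//; last 2 first.
  - exact: measurable_funTS.
  - by move=> w _; rewrite lee_fin ltW.
  rewrite integral_cst; last exact: mN.
  (* Cancelling the integral of [Z] is legitimate because it is finite; what remains is
     [c n * P (N n) <= 0]. *)
  rewrite -[leRHS]adde0 leeD2lE// => cP.
  apply/eqP; rewrite eq_le measure_ge0 andbT.
  by rewrite -(@pmule_rle0 _ (c n)%:E) ?lte_fin//; exact: cP.
apply: negligibleS null => w /= /negP; rewrite -ltNge.
have := Z0 w; case ZE' : (Z w) => [z| |] // z0; last by rewrite ltNge leey.
move=> zH.
have [r r0 rH] : exists2 r : R, (0 < r)%R & r%:E <= H (X w) - z%:E.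
  case: (H (X w)) zH => [h| |]//= zh.
  - by exists (h - z)%R => //; rewrite subr_gt0 -lte_fin.
  - by exists 1%R; rewrite ?leey.
(* This index exceeds both [z] and [1/r], giving [Z w <= m] and [c m <= r]. *)
pose m := maxn (Num.bound z) (Num.bound r^-1).
exists m => //; split => /=.
  rewrite ZE' lee_fin (le_trans (ltW (archi_boundP _)))//.
  by rewrite ler_nat leq_maxl.
rewrite ZE'; apply: le_trans rH; rewrite lee_fin /c invf_ple ?posrE//.
have ri : (r^-1 < (Num.bound r^-1)%:R)%R.
  by apply: archi_boundP; rewrite invr_ge0 ltW.
by rewrite (le_trans (ltW ri))// ler_nat leqW// leq_maxr.
Qed.

(** * Transfer of the inequality to the random variables *)

Theorem theorem4p2 (d : measure_display) (T : measurableType d) (R : realType)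
    (P : probability T R) (X Y : {RV P >-> R}) (F : R -> R)
    (hXY : independent_RV X Y)
    (hX : forall x : R, cdf X x = (F x)%:E)
    (hY : forall x : R, cdf Y x = (F x)%:E)
    (psi : R -> R) (psi_meas : measurable_fun [set: R] psi)
    (psi_ge0 : forall y : R, (0 <= psi y)%R)
    (p : R) (p_gt0 : (0 < p)%R) (p_lt1 : (p < 1)%R)
    (Z : T -> \bar R)
    (hZ : is_condexp X
      (fun w => (psi (Y w) / F (Y w) * \1_[set w' | (X w' <= Y w')%R] w)%:E) Z) :
  (\int[P]_w (Z w `^ p)) `^ p^-1 >=
    p%:E * 'E_P[fun w => (psi (Y w) `^ p)%R] `^ p^-1.
Proof.
pose mu : probability R R := distribution P X.
have YX A : measurable A -> distribution P Y A = mu A.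
  move=> mA.
  apply: (@probability_eq_rays R (distribution P Y) (distribution P X)) => // x.
  by have := hX x; rewrite -hY.
have FE (y : R) : fine (mu [set` `]-oo, y]]) = F y.
  by have /= := hX y; rewrite /cdf => ->.
have F0 (y : R) : (0 <= F y)%R by rewrite -FE fine_ge0.
have mF : measurable_fun setT F.
  apply: nondecreasing_measurable => // x y xy.
  by rewrite -lee_fin -!hX; exact: cdf_nondecreasing.
pose g (y : R) : R := (psi y / F y)%R.
have g0 (y : R) : (0 <= g y)%R by exact: divr_ge0.
have mg : measurable_fun setT g by exact: measurable_fun_div_ge0.
pose G (x : R) := \int[mu]_(y in `[x, +oo[) (g y)%:E.
have G0 x : 0 <= G x by apply: integral_ge0 => y _; rewrite lee_fin.
have mG : measurable_fun setT G by have [] := tail_integral_tonelli mu mg g0.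
have GZ : {ae P, forall w, G (X w) <= Z w}.
  apply: (condexp_ge hZ) => // B mB.
  pose A : set (R * R) := [set z | (z.1 <= z.2)%R].
  have mA : measurable A by exact: measurable_ler_graph.
  pose f (z : R * R) : \bar R := (g z.2 * \1_A z * \1_B z.1)%:E.
  have mf : measurable_fun setT f.
    apply/measurable_EFinP; apply: measurable_funM; last first.
      exact: (measurableT_comp (measurable_indic mB) measurable_fst).
    apply: measurable_funM; last exact: measurable_indic.
    exact: measurableT_comp mg measurable_snd.
  have f0 z : 0 <= f z.
    by rewrite lee_fin; apply: mulr_ge0 => //; apply: mulr_ge0.
  transitivity (\int[mu]_(x in B) G x).
    apply/esym/(@ge0_integral_pushforward _ _ _ _ _ X) => //.
    exact: measurable_funTS.
  transitivity (\int[P]_w f (X w, Y w)).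
    rewrite (independent_RV_tonelli hXY mf f0) [LHS]integral_mkcond.
    apply: eq_integral => x _.
    rewrite (@eq_measure_integral _ _ _ _ mu (distribution P Y))//; last first.
      by move=> C mC _; exact: YX.
    rewrite patchE; case: ifPn => [xB|xB].
      rewrite /G [LHS]integral_mkcond; apply: eq_integral => y _.
      rewrite patchE /f /= !indicE xB mulr1; case: ifPn.
        by rewrite inE/= in_itv/= andbT => xy; rewrite mem_set// mulr1.
      by rewrite notin_setE/= in_itv/= andbT => xy; rewrite memNset// mulr0.
    by rewrite integral0_eq// => y _; rewrite /f/= !indicE (negbTE xB) mulr0.
  rewrite [RHS]integral_mkcond; apply: eq_integral => w _.
  rewrite patchE /f /g /= !indicE.
  have -> : (w \in X @^-1` B) = (X w \in B) by [].
  have -> : ((X w, Y w) \in A) = (w \in [set w' | (X w' <= Y w')%R]) by [].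
  by case: ifPn => _; rewrite ?mulr1 ?mulr0.
have EY : 'E_P[fun w => (psi (Y w) `^ p)%R] = \int[mu]_y (psi y `^ p)%:E.
  rewrite unlock.
  have mpsip : measurable_fun setT (fun y => (psi y `^ p)%:E).
    by apply/measurable_EFinP; exact: (measurableT_comp (measurable_powR p)).
  rewrite -[LHS](@ge0_integral_distribution _ _ _ _ _ _ Y _ mpsip); last first.
    by move=> y; rewrite lee_fin powR_ge0.
  by apply: eq_measure_integral => C mC _; exact: YX.
have mGp : measurable_fun setT (fun x => G x `^ p).
  exact: (measurableT_comp (measurable_poweR p)).
have mZ : measurable_fun setT Z.
  have [_ mZ _] := hZ => _ C mC; have [B mB <-] := mZ measurableT C mC.
  exact: measurable_funP.
have EZ : \int[mu]_x (G x `^ p) <= \int[P]_w (Z w `^ p).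
  rewrite [leLHS](@ge0_integral_distribution _ _ _ _ _ _ X _ mGp); last first.
    by move=> x; exact: poweR_ge0.
  apply: ae_ge0_le_integral => //.
  - by move=> w _; exact: poweR_ge0.
  - exact: measurableT_comp.
  - by move=> w _; exact: poweR_ge0.
  - exact: (measurableT_comp (measurable_poweR p)).
  - apply: filterS GZ => w GZw _; apply: gt0_ler_poweR => //; first exact: ltW.
      by rewrite in_itv/= G0 leey.
    by rewrite in_itv/= (le_trans (G0 _) GZw) leey.
(* Writing [p] as a [1/p]-th power moves it under the outer exponent, and monotonicity of [t^(1/p)]
   reduces the goal to [hardy]. *)
have pp : p%:E = (p `^ p)%:E `^ p^-1.
  by rewrite poweR_EFin -powRrM mulfV ?gt_eqF// powRr1// ltW.
have I0 : 0 <= \int[mu]_y (psi y `^ p)%:E.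
  by apply: integral_ge0 => y _; rewrite lee_fin powR_ge0.
have J0 : 0 <= (p `^ p)%:E * \int[mu]_y (psi y `^ p)%:E.
  by rewrite mule_ge0// lee_fin powR_ge0.
rewrite EY [X in X * _]pp -poweRM ?lee_fin ?powR_ge0//.
have hardy : (p `^ p)%:E * \int[mu]_y (psi y `^ p)%:E <= \int[P]_w (Z w `^ p).
  apply: le_trans EZ.
  apply: le_trans (hardy_tail mu psi_meas psi_ge0 p_gt0 p_lt1) _.
  rewrite le_eqVlt; apply/orP; left; apply/eqP; apply: eq_integral => x _.
  by congr (_ `^ _); apply: eq_integral => y _; rewrite /g -FE.
apply: (gt0_ler_poweR _ _ _ hardy).
- by rewrite invr_ge0 ltW.
- by rewrite in_itv/= J0 leey.
- by rewrite in_itv/= (le_trans J0 hardy) leey.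
Qed.
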